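(* Let $u$ be real, $b$ a positive integer, and $n\ge1$ an integer. Then $$V(u,b)=\max\{u/b,\ \mathrm{TreeSum}(n,u,b)\}.$$ It is optimal to stop at $(u,b)$ (that is, $V(u,b)=u/b$) if $\mathrm{TreeSum}(n,u,b)\le u/b$, and otherwise one should continue (that is, $V(u,b)>u/b$). Moreover, if $\mathrm{TreeSum}(1,u,b)>u/b$ then $\mathrm{TreeSum}(1,u,b)=\mathrm{TreeSum}(n,u,b)$.
   Context: Let $X_1,X_2,\dots$ be i.i.d. with $P(X_i=1)=P(X_i=-1)=1/2$ and $S_k=\sum_{i=1}^k X_i$, $S_0=0$. For real $u$ and positive integer $b$, $V(u,b)=\sup_T E\left[\frac{u+S_T}{b+T}\right]$, the supremum over all a.s. finite stopping times $T$ (with values in $\{0,1,2,\dots\}$) of the walk. Let $C_m=\frac1{m+1}\binom{2m}{m}$ ($m\ge0$) be the Catalan numbers and $B(n,j)=\frac jn\binom{2n}{n-j}$ ($1\le j\le n$) the Shapiro Catalan triangle. Define, for $n\ge1$, $$\mathrm{TreeSum}(n,u,b)=\sum_{m=0}^{n-1}2^{-2m-1}C_m\,V(u+1,b+2m+1)+2^{-2n+1}\sum_{j=1}^nB(n,j)\,V(u-2j+1,b+2n-1).$$ In particular $\mathrm{TreeSum}(1,u,b)=\frac12V(u+1,b+1)+\frac12V(u-1,b+1)$. *)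

(* Defs.v *)
From HB Require Import structures.
From mathcomp Require Import all_boot all_order all_algebra.
From mathcomp Require Import finmap.
From mathcomp Require Import all_classical all_reals all_analysis.
Import Order.TTheory GRing.Theory Num.Theory.
Import numFieldNormedType.Exports.

Set Implicit Arguments.
Unset Strict Implicit.
Unset Printing Implicit Defensive.

Local Open Scope classical_set_scope.
Local Open Scope ring_scope.

Section walk.
Context {d : measure_display} {Omega : measurableType d} {R : realType}
        {P : probability Omega R}.
(* Indices are shifted by one: [X i] is the mathematical X_(i+1). *)
Implicit Type X : nat -> {RV P >-> R}.

Definition mutually_independent X : Prop :=
  forall (J : {fset nat}) (B : nat -> set R), (forall i, measurable (B i)) ->
    P (\bigcap_(i in [set` J]) (X i @^-1` B i)) =
    (\prod_(i <- J) P (X i @^-1` B i))%E.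

Definition fair_signs X : Prop :=
  forall i, P (X i @^-1` [set 1]) = (2^-1)%:E /\
            P (X i @^-1` [set -1]) = (2^-1)%:E.

Definition walk X (k : nat) (w : Omega) : R := \sum_(i < k) X i w.

Definition natural_filtration X (n : nat) : set_system Omega :=
  <<s \bigcup_(k in `I_n.+1) preimage_set_system setT (walk X k) measurable >>.

(* [None] stands for the value +oo. *)
Definition stopping_time X (tau : Omega -> option nat) : Prop :=
  forall n, natural_filtration X n [set w | tau w = Some n].

Definition ae_finite_stopping_time X (tau : Omega -> option nat) : Prop :=
  stopping_time X tau /\ {ae P, forall w, tau w <> None}.

(* The value 0 on {tau = +oo} is immaterial: this event is negligible for the
   stopping times considered. *)
Definition payoff X (u : R) (b : nat) (tau : Omega -> option nat) (w : Omega)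
    : R :=
  if tau w is Some k then (u + walk X k w) / (b + k)%:R else 0.

(* Extended-real valued, so that the supremum needs no default value; for
   0 < b the payoffs are bounded by max(|u| / b, 1) almost surely, hence V is
   finite. *)
Definition V X (u : R) (b : nat) : \bar R :=
  ereal_sup [set 'E_P[payoff X u b tau]%E | tau in ae_finite_stopping_time X].

End walk.

Definition catalan (R : realType) (m : nat) : R :=
  'C(2 * m, m)%:R / m.+1%:R.

Definition shapiro (R : realType) (n j : nat) : R :=
  j%:R / n%:R * 'C(2 * n, n - j)%:R.

Definition TreeSum {d : measure_display} {Omega : measurableType d}
    {R : realType} {P : probability Omega R} (X : nat -> {RV P >-> R})
    (n : nat) (u : R) (b : nat) : \bar R :=
  (\sum_(0 <= m < n)
      (2 ^- (2 * m + 1) * catalan R m)%:E * V X (u + 1) (b + 2 * m + 1)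
   + (2 ^- (2 * n - 1))%:E *
      \sum_(1 <= j < n.+1)
        (shapiro R n j)%:E * V X (u - (2 * j)%:R + 1) (b + 2 * n - 1))%E.

(* Main.v *)
Require Import Defs.
From mathcomp Require Import all_boot all_order all_algebra.
From mathcomp Require Import finmap.
From mathcomp Require Import all_classical all_reals all_analysis.
From mathcomp Require Import measurable_realfun ring lra zify.
Import Order.TTheory GRing.Theory Num.Theory.
Import numFieldNormedType.Exports.

(** The walk almost surely takes values +-1, and every event of the natural
    filtration at time [n] either contains or misses each cylinder of length
    [n]. Backward induction over cylinders, together with dominated convergence
    for unbounded stopping times, identifies [V X u b] with the real number
    [value u b], the limit of the finite-horizon values [Vfin N u b] given by
    dynamic programming; hence the Bellman equation
      [value u b = max (u / b) (continuation u b)].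

    Two monotonicity properties show that continuing at [(u, b)] forces
    continuing at [(u', b')] whenever [u' <= u] and [b <= b']: raising [u] by
    [t] raises the value by at most [t / b], and [b * value u b] is
    nondecreasing in [b].

    TreeSum(n) is the expected value when the walk is run until it first hits
    [+1] or until time [2n - 1]. Going from [n] to [n + 1] replaces the values
    at time [2n - 1] by two-step averages. These never exceed the values, and
    equal them if it is optimal to continue at [(u, b)], as all the positions
    involved lie below [u]. So TreeSum(n) <= TreeSum(1), with equality when
    [u / b < value u b]. *)

Set Implicit Arguments.
Unset Strict Implicit.
Unset Printing Implicit Defensive.

Local Open Scope classical_set_scope.
Local Open Scope ring_scope.

(** * The finite-horizon game *)

Section game_value.
Context {R : realType}.
Implicit Types (u : R) (b N n : nat).

Fixpoint Vfin N u b : R :=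
  if N is N'.+1 then
    Num.max (u / b%:R) ((Vfin N' (u + 1) b.+1 + Vfin N' (u - 1) b.+1) / 2)
  else u / b%:R.

Lemma le_Vfin_stop N u b : u / b%:R <= Vfin N u b.
Proof. by case: N => [|N] //=; rewrite le_max lexx. Qed.

Lemma Vfin_homo u b :
  {homo (fun N => Vfin N u b) : M N / (M <= N)%N >-> M <= N}.
Proof.
apply: homo_leq => [//|y x z /le_trans|N]; first exact.
elim: N u b => [|N IHN] u b; first exact: le_Vfin_stop.
by rewrite [leLHS]/= [leRHS]/= le_max2 ?lexx ?orbT// ler_pM2r ?lerD//.
Qed.

(** As [K >= 1], the hypothesis survives a step: [|u|] grows by at most 1 and [K * b] grows by
    [K]. *)
Lemma Vfin_le_bound K N u b : (0 < b)%N -> 1 <= K -> `|u| <= K * b%:R ->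
  Vfin N u b <= K.
Proof.
move=> + K1; elim: N u b => [|N IHN] u b b0 ub /=.
  by rewrite ler_pdivrMr ?ltr0n// (le_trans (ler_norm u)).
rewrite ge_max ler_pdivrMr ?ltr0n// (le_trans (ler_norm u))//=.
have bS : K * b.+1%:R = K * b%:R + K by rewrite -natr1; ring.
have := IHN (u + 1) b.+1 isT; have := IHN (u - 1) b.+1 isT.
rewrite bS => H1 H2.
have {}H1 : Vfin N (u - 1) b.+1 <= K.
  by apply: H1; rewrite (le_trans (ler_normB _ _))// normr1 lerD.
have {}H2 : Vfin N (u + 1) b.+1 <= K.
  by apply: H2; rewrite (le_trans (ler_normD _ _))// normr1 lerD.
lra.
Qed.

(** The left side is the expected payoff of waiting for all [N] steps, the walk having mean zero. *)
Lemma le_Vfin_drift N u b : u / (b + N)%:R <= Vfin N u b.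
Proof.
elim: N u b => [|N IHN] u b /=; first by rewrite addn0.
rewrite le_max; apply/orP; right.
have := IHN (u + 1) b.+1; have := IHN (u - 1) b.+1.
rewrite addSnnS; set c := (_ + _)%:R^-1; lra.
Qed.

(** Under any stopping rule [T], raising the start by [t] adds [t / (b + T) <= t / b] to the
    payoff. *)
Lemma Vfin_shift_le N u b (t : R) : (0 < b)%N -> 0 <= t ->
  Vfin N (u + t) b <= Vfin N u b + t / b%:R.
Proof.
move=> + t0; elim: N u b => [|N IHN] u b b0 /=; first by rewrite mulrDl.
rewrite ge_max mulrDl lerD2r le_max lexx/=.
have := IHN (u + 1) b.+1 isT; have := IHN (u - 1) b.+1 isT.
rewrite ![u + _ + t]addrAC => H1 H2.
have tb : t / b.+1%:R <= t / b%:R.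
  by apply: ler_wpM2l => //; rewrite lef_pV2 ?posrE ?ltr0n// ler_nat.
have : (Vfin N (u + 1) b.+1 + Vfin N (u - 1) b.+1) / 2 <=
    Num.max (u / b%:R) ((Vfin N (u + 1) b.+1 + Vfin N (u - 1) b.+1) / 2).
  by rewrite le_max lexx orbT.
move: H1 H2 tb; set m := Num.max (u / _) _; set x := t / _; set y := t / _.
clearbody m x y.
lra.
Qed.

(** * The infinite-horizon value and its Bellman equation *)

Definition value u b : R := sup (range (fun N => Vfin N u b)).

Lemma has_sup_Vfin u b : (0 < b)%N -> has_sup (range (fun N => Vfin N u b)).
Proof.
move=> b0; split; first by exists (Vfin 0 u b); exists 0%N.
exists (Num.max 1 (`|u| / b%:R)) => _ [N _ <-].
apply: Vfin_le_bound => //; first by rewrite le_max lexx.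
by rewrite -ler_pdivrMr ?ltr0n// le_max lexx orbT.
Qed.

Lemma Vfin_le_value N u b : (0 < b)%N -> Vfin N u b <= value u b.
Proof.
by move=> b0; apply: ub_le_sup; [have [] := has_sup_Vfin u b0|exists N].
Qed.

Lemma value_le u b (c : R) : (forall N, Vfin N u b <= c) -> value u b <= c.
Proof.
move=> H; apply: ge_sup; first by exists (Vfin 0 u b); exists 0%N.
by move=> _ [N _ <-].
Qed.

Lemma le_value_stop u b : (0 < b)%N -> u / b%:R <= value u b.
Proof. by move=> b0; exact: (Vfin_le_value 0). Qed.

Lemma value_ge0 u b : (0 < b)%N -> 0 <= value u b.
Proof.
move=> b0; rewrite leNgt; apply/negP => v0.
have vu N : u / (b + N)%:R <= value u b.
  by rewrite (le_trans (le_Vfin_drift N u b))// Vfin_le_value.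
(* Such an [N] makes [value u b * (b + N)] less than [u], against [vu]. *)
have [N hN] : exists N, `|u| / - value u b < N%:R.
  by exists (Num.truncn (`|u| / - value u b)).+1; exact: truncnS_gt.
have bN0 : 0 < (b + N)%:R :> R by rewrite ltr0n addn_gt0 b0.
have := vu N; rewrite ler_pdivrMr// leNgt => /negP; apply.
move: hN; rewrite ltr_pdivrMr ?oppr_gt0// => hN.
have : - u <= `|u| by rewrite -normrN ler_norm.
have : 0 <= b%:R * - value u b by rewrite mulr_ge0// oppr_ge0 ltW.
by rewrite natrD; lra.
Qed.

Definition continuation u b : R :=
  (value (u + 1) b.+1 + value (u - 1) b.+1) / 2.

Lemma continuation_le_value u b : (0 < b)%N -> continuation u b <= value u b.
Proof.
move=> b0; rewrite /continuation.
(* The suprema are isolated one at a time; monotonicity in the horizon then merges the two horizons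
   into their maximum. *)
suff : value (u + 1) b.+1 <= 2 * value u b - value (u - 1) b.+1 by lra.
apply: value_le => N.
suff : value (u - 1) b.+1 <= 2 * value u b - Vfin N (u + 1) b.+1 by lra.
apply: value_le => M.
have := Vfin_homo (u + 1) b.+1 (leq_maxl N M).
have := Vfin_homo (u - 1) b.+1 (leq_maxr N M).
have := Vfin_le_value (maxn N M).+1 u b0; rewrite /= ge_max => /andP[_].
lra.
Qed.

Lemma value_bellman u b : (0 < b)%N ->
  value u b = Num.max (u / b%:R) (continuation u b).
Proof.
move=> b0; apply/eqP; rewrite eq_le ge_max le_value_stop//=.
rewrite continuation_le_value// andbT; apply: value_le => -[|N] /=; first by rewrite le_max lexx.
rewrite le_max2// ler_pM2r// lerD// Vfin_le_value//.
Qed.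

Lemma value_shift_le u b (t : R) : (0 < b)%N -> 0 <= t ->
  value (u + t) b <= value u b + t / b%:R.
Proof.
move=> b0 t0; apply: value_le => N.
by rewrite (le_trans (Vfin_shift_le N u b0 t0))// lerD2r Vfin_le_value.
Qed.

(* Since [value] is nonnegative, replacing the payoff [u / b] by its positive
   part does not change it; for this payoff, [b * Vfin_pos N u b] is
   nondecreasing in [b] by induction on [N], as [b * (b + 2) <= (b + 1) ^ 2]. *)
Fixpoint Vfin_pos N u b : R :=
  if N is N'.+1 then
    Num.max (Num.max u 0 / b%:R)
            ((Vfin_pos N' (u + 1) b.+1 + Vfin_pos N' (u - 1) b.+1) / 2)
  else Num.max u 0 / b%:R.

Lemma Vfin_le_pos N u b : Vfin N u b <= Vfin_pos N u b.
Proof.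
have ub v c : v / c%:R <= Num.max v 0 / c%:R :> R.
  by rewrite ler_wpM2r// le_max lexx.
elim: N u b => [|N IHN] u b //=.
by rewrite le_max2// ler_pM2r// lerD.
Qed.

Lemma Vfin_pos_ge0 N u b : 0 <= Vfin_pos N u b.
Proof.
have p0 : 0 <= Num.max u 0 / b%:R by rewrite divr_ge0// le_max lexx orbT.
by case: N => [|N] //=; rewrite le_max p0.
Qed.

Lemma Vfin_pos_le_value N u b : (0 < b)%N -> Vfin_pos N u b <= value u b.
Proof.
have ub v c : (0 < c)%N -> Num.max v 0 / c%:R <= value v c.
  move=> c0; rewrite ler_pdivrMr ?ltr0n// ge_max -ler_pdivrMr ?ltr0n//.
  by rewrite le_value_stop// mulr_ge0// value_ge0.
elim: N u b => [|N IHN] u b b0 /=; first exact: ub.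
rewrite ge_max ub//= (le_trans _ (continuation_le_value u b0))//.
by rewrite ler_pM2r// lerD// IHN.
Qed.

Lemma Vfin_pos_scale N u b : (0 < b)%N ->
  b%:R * Vfin_pos N u b <= b.+1%:R * Vfin_pos N u b.+1.
Proof.
elim: N u b => [|N IHN] u b b0 /=.
  by rewrite mulrC divfK ?pnatr_eq0 -?lt0n// mulrC divfK ?pnatr_eq0.
have b0' : 0 < b%:R :> R by rewrite ltr0n.
have b1' : 0 < b.+1%:R :> R by rewrite ltr0n.
rewrite !maxr_pMr ?ler0n// mulrC divfK ?gt_eqF//.
rewrite [X in Num.max X _ <= _](_ : _ =
    b.+1%:R * (Num.max u 0 / b.+1%:R)); last first.
  by rewrite mulrC divfK// gt_eqF.
apply: le_max2 => //.
have := IHN (u + 1) b.+1 isT; have := IHN (u - 1) b.+1 isT.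
have := Vfin_pos_ge0 N (u + 1) b.+2; have := Vfin_pos_ge0 N (u - 1) b.+2.
set x := Vfin_pos _ _ b.+2; set y := Vfin_pos _ _ b.+2.
set x' := Vfin_pos _ _ b.+1; set y' := Vfin_pos _ _ b.+1.
move=> x0 y0 xx yy.
rewrite -(ler_pM2l b1') [leLHS](_ : _ =
  b%:R * ((b.+1%:R * x' + b.+1%:R * y') / 2)); last by ring.
apply: (@le_trans _ _ (b%:R * ((b.+2%:R * x + b.+2%:R * y) / 2))).
  by rewrite ler_pM2l// ler_pM2r// addrC [leRHS]addrC lerD//.
rewrite -[b.+2%:R]natr1 -[b.+1%:R]natr1; nra.
Qed.

Lemma value_scale u b b' : (0 < b)%N -> (b <= b')%N ->
  b%:R * value u b <= b'%:R * value u b'.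
Proof.
move=> b0 /subnK <-; elim: (b' - b)%N => [|k IHk]; first by rewrite add0n.
have kb0 : (0 < k + b)%N by rewrite addn_gt0 b0 orbT.
have kb0' : 0 < (k + b)%:R :> R by rewrite ltr0n.
rewrite (le_trans IHk)// mulrC -ler_pdivlMr//; apply: value_le => N.
rewrite ler_pdivlMr// mulrC.
apply: (le_trans (y := (k + b)%:R * Vfin_pos N u (k + b))).
  by rewrite ler_pM2l// Vfin_le_pos.
rewrite (le_trans (Vfin_pos_scale N u kb0))// addSn ler_pM2l ?ltr0n//.
exact: Vfin_pos_le_value.
Qed.

(** By contraposition: if stopping is optimal at [(u', b')], the shift bound gives
    [value u b' <= u / b'], and scaling gives [b * value u b <= b' * value u b' <= u]. *)
Lemma continue_mono u u' b b' : (0 < b)%N -> (b <= b')%N -> u' <= u ->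
  u / b%:R < value u b -> u' / b'%:R < value u' b'.
Proof.
move=> b0 bb' u'u; rewrite !ltNge; apply: contra => stop.
have b'0 : (0 < b')%N by exact: leq_trans bb'.
have b0' : 0 < b%:R :> R by rewrite ltr0n.
have b'0' : 0 < b'%:R :> R by rewrite ltr0n.
have := value_shift_le u' b'0 (t := u - u').
rewrite subr_ge0 addrC subrK => /(_ u'u) Wu.
rewrite ler_pdivlMr// mulrC (le_trans (value_scale u b0 bb'))//.
rewrite mulrC -ler_pdivlMr// (le_trans Wu)//.
by rewrite mulrBl; lra.
Qed.

Lemma value_continue u u' b b' : (0 < b)%N -> (b <= b')%N -> u' <= u ->
  u / b%:R < value u b -> value u' b' = continuation u' b'.
Proof.
move=> b0 bb' u'u /(continue_mono b0 bb' u'u).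
have b'0 : (0 < b')%N by exact: leq_trans bb'.
by rewrite value_bellman// lt_max ltxx/= => /ltW/max_idPr.
Qed.

End game_value.

(** * Tree sums *)

Section tree.
Context {R : realType}.
Implicit Types (u : R) (b m n j : nat).

(* [ballot m j] is B(m + 1, j), in a form that vanishes for [j = 0] and for
   [j > m + 1] and that satisfies Pascal's rule without side conditions. *)
Definition ballot m j : R :=
  'C(2 * m + 1, m + j)%:R - 'C(2 * m + 1, m + j + 1)%:R.

Lemma ballot0 m : ballot m 0 = 0.
Proof.
rewrite /ballot addn0 -[X in X - _](_ : 'C(2 * m + 1, m + 1)%:R = _) ?subrr//.
by rewrite -bin_sub; [congr (_%:R); congr binomial; lia|lia].
Qed.

Lemma ballot_large m j : (m + 1 < j)%N -> ballot m j = 0.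
Proof. by move=> mj; rewrite /ballot !bin_small ?subrr//; lia. Qed.

(** By the reflection principle, for [j >= 1], [ballot m j] counts the walks of length [2 * m + 1]
    that avoid +1 and end at [1 - 2 * j]; two more steps give the weights 1, 2, 1. The proof applies
    Pascal's rule twice. *)
Lemma ballot_rec m j :
  ballot m.+1 j.+1 = ballot m j + 2 * ballot m j.+1 + ballot m j.+2.
Proof.
rewrite /ballot (_ : 2 * m.+1 + 1 = (2 * m + 1).+2)%N; last by lia.
rewrite (_ : m.+1 + j.+1 = (m + j).+2)%N; last by lia.
rewrite !addn1 !addnS !binS !natrD; ring.
Qed.

Lemma natr_mul_bin_left (p k : nat) : (k <= p)%N ->
  k.+1%:R * 'C(p, k.+1)%:R = (p%:R - k%:R) * 'C(p, k)%:R :> R.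
Proof. by move=> kp; rewrite -natrB// -!natrM mul_bin_left. Qed.

Lemma shapiroE m j : (j <= m.+1)%N -> shapiro R m.+1 j = ballot m j.
Proof.
move=> jm; rewrite /shapiro /ballot -bin_sub; last by lia.
rewrite (_ : _ - (_ - _) = (m + j).+1)%N; last by lia.
rewrite (_ : 2 * m.+1 = (2 * m + 1).+1)%N; last by lia.
rewrite binS natrD !addn1.
(* The ratio [(m + 1 - j) / (m + j + 1)] of the two consecutive binomials turns [j] times their sum
   into [m + 1] times their difference. *)
have := @natr_mul_bin_left (2 * m).+1 (m + j) ltac:(lia).
move: ('C(_, _)%:R : R) ('C(_, _)%:R : R) => y x.
rewrite -![_.+1%:R]natr1 natrD natrM => h.
have m0 : m%:R + 1 != 0 :> R by rewrite natr1 pnatr_eq0.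
apply: (mulIf m0).
rewrite mulrAC divfK//; move: h; lra.
Qed.

(** In terms of walks: a first visit to +1 at time [2 * m + 3] means being at -1 at time [2 * m + 1]
    and then going up twice. *)
Lemma catalan_ballot m : catalan R m.+1 = ballot m 1.
Proof.
rewrite /catalan /ballot (_ : 2 * m.+1 = (2 * m + 1).+1)%N; last by lia.
rewrite binS natrD !addn1.
have -> : 'C((2 * m).+1, m) = 'C((2 * m).+1, m.+1).
  by rewrite -bin_sub; [congr binomial; lia|lia].
have := @natr_mul_bin_left (2 * m).+1 m.+1 ltac:(lia).
move: ('C(_, _)%:R : R) ('C(_, _)%:R : R) => y x.
rewrite -![_.+1%:R]natr1 natrM => h.
have m0 : m%:R + 1 + 1 != 0 :> R by rewrite !natr1 pnatr_eq0.
by apply: (mulIf m0); rewrite divfK//; move: h; lra.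
Qed.

(** Two steps from the position of index [j] lead to the indices [j - 1], [j], [j + 1]. Regrouping
    by target uses [ballot_rec]; the term in [G 0] collects the walks absorbed at +1. *)
Lemma sum_ballot_step m (G : nat -> R) :
  \sum_(1 <= j < m.+2) ballot m j * (G j.-1 + 2 * G j + G j.+1) =
  ballot m 1 * G 0%N + \sum_(1 <= j < m.+3) ballot m.+1 j * G j.
Proof.
rewrite !big_add1 /=.
under eq_bigr do rewrite 2!mulrDr.
under [in RHS]eq_bigr do rewrite ballot_rec 2!mulrDl.
rewrite !big_split/=.
have -> : \sum_(0 <= i < m.+2) ballot m i * G i.+1 =
          \sum_(0 <= i < m.+1) ballot m i.+1 * G i.+2.
  by rewrite big_nat_recl// ballot0 mul0r add0r.
have -> : \sum_(0 <= i < m.+2) ballot m i.+2 * G i.+1 =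
          \sum_(0 <= i < m) ballot m i.+2 * G i.+1.
  by rewrite !big_nat_recr//= !ballot_large ?mul0r ?addr0//; lia.
rewrite big_nat_recl//.
have -> : \sum_(0 <= i < m.+2) 2 * ballot m i.+1 * G i.+1 =
          \sum_(0 <= i < m.+1) ballot m i.+1 * (2 * G i.+1).
  rewrite big_nat_recr//= ballot_large ?mulr0 ?mul0r ?addr0; last by lia.
  by apply: eq_bigr => i _; ring.
by ring.
Qed.

(** * Tree sums compared through two-step averages *)

Definition treesum n u b : R :=
  \sum_(0 <= m < n)
    2 ^- (2 * m + 1) * catalan R m * value (u + 1) (b + 2 * m + 1)
  + 2 ^- (2 * n - 1) *
    \sum_(1 <= j < n.+1)
      shapiro R n j * value (u - (2 * j)%:R + 1) (b + 2 * n - 1).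

Definition two_step u b : R :=
  (value (u + 2) b.+2 + 2 * value u b.+2 + value (u - 2) b.+2) / 4.

Lemma two_stepE u b :
  two_step u b = (continuation (u + 1) b.+1 + continuation (u - 1) b.+1) / 2.
Proof.
rewrite /two_step /continuation addrK subrK.
rewrite (_ : u + 1 + 1 = u + 2); last by ring.
rewrite (_ : u - 1 - 1 = u - 2); last by ring.
by field.
Qed.

Lemma two_step_le u b : (0 < b)%N -> two_step u b <= value u b.
Proof.
move=> b0; rewrite two_stepE (le_trans _ (continuation_le_value u b0))//.
by rewrite ler_pM2r// lerD// continuation_le_value.
Qed.

Lemma treesum1 u b : treesum 1 u b = continuation u b.
Proof.
rewrite /treesum !big_nat1 /catalan /shapiro /continuation.
rewrite muln0 muln1 bin0 subnn bin0.
rewrite (_ : 2 * 1 - 1 = 1)%N// addn0 !divr1 !mul1r mulr1 -exprVn expr1.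
rewrite (_ : (b + 2 - 1 = b.+1)%N); last by lia.
rewrite addn1 (_ : u - 2%:R + 1 = u - 1); last by ring.
by ring.
Qed.

(** The new Catalan term supplies the weight that the two-step averages put on [u + 1]; the new last
    sum supplies the rest. *)
Lemma treesumS_eq m u b : treesum m.+2 u b - treesum m.+1 u b =
  2 ^- (2 * m + 1) * \sum_(1 <= j < m.+2) ballot m j *
    (two_step (u - (2 * j)%:R + 1) (b + 2 * m + 1)
     - value (u - (2 * j)%:R + 1) (b + 2 * m + 1)).
Proof.
pose G j := value (u - (2 * j)%:R + 1) (b + 2 * m + 3).
rewrite /treesum big_nat_recr//=.
rewrite (_ : 2 * m.+1 - 1 = 2 * m + 1)%N; last by lia.
rewrite (_ : 2 * m.+2 - 1 = 2 * m + 1 + 2)%N; last by lia.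
rewrite (_ : 2 * m.+1 + 1 = 2 * m + 1 + 2)%N; last by lia.
rewrite (_ : b + 2 * m.+1 - 1 = b + 2 * m + 1)%N; last by lia.
rewrite (_ : b + 2 * m.+1 + 1 = b + 2 * m + 3)%N; last by lia.
rewrite (_ : b + 2 * m.+2 - 1 = b + 2 * m + 3)%N; last by lia.
set S := \sum_(0 <= _ < _) _.
rewrite [X in _ + X - _](_ : _ =
    2 ^- (2 * m + 1 + 2) * \sum_(1 <= j < m.+3) ballot m.+1 j * G j);
  last first.
  by congr (_ * _); apply: eq_big_nat => j ?; rewrite shapiroE//; lia.
rewrite [X in _ - (_ + _ * X)](_ : _ = \sum_(1 <= j < m.+2) ballot m j *
    value (u - (2 * j)%:R + 1) (b + 2 * m + 1)); last first.
  by apply: eq_big_nat => j ?; rewrite shapiroE//; lia.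
have G0 : value (u + 1) (b + 2 * m + 3) = G 0%N by rewrite /G muln0 subr0.
rewrite G0 catalan_ballot.
have := sum_ballot_step m G.
under [in X in _ -> X]eq_bigr do rewrite mulrBr.
rewrite sumrB.
have -> : \sum_(1 <= j < m.+2) ballot m j *
     two_step (u - (2 * j)%:R + 1) (b + 2 * m + 1) =
   (\sum_(1 <= j < m.+2) ballot m j * (G j.-1 + 2 * G j + G j.+1)) / 4.
  rewrite mulr_suml; apply: eq_big_nat => -[//|j] _.
  rewrite -mulrA; congr (_ * (_ / _)); rewrite /G /=.
  rewrite (_ : (b + 2 * m + 1).+2 = b + 2 * m + 3)%N; last by lia.
  rewrite !mulnS !natrD.
  by congr (value _ _ + _ * value _ _ + value _ _); ring.
rewrite (_ : 2 ^- (2 * m + 1 + 2) = 2 ^- (2 * m + 1) / 4 :> R); last first.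
  by rewrite exprD invfM; congr (_ * _); congr (_ ^-1); ring.
move=> ->.
by field.
Qed.

Lemma ballot_ge0 m j : (j <= m.+1)%N -> 0 <= ballot m j.
Proof. by move=> jm; rewrite -shapiroE// /shapiro mulr_ge0// divr_ge0. Qed.

Lemma treesum_le_continuation n u b : (0 < b)%N -> (0 < n)%N ->
  treesum n u b <= continuation u b.
Proof.
case: n => // n b0 _; rewrite -treesum1; elim: n => [//|n IHn].
apply: le_trans IHn; rewrite -subr_le0 treesumS_eq.
rewrite mulr_ge0_le0 ?invr_ge0 ?exprn_ge0// big_nat_cond sumr_le0// => j.
move=> /andP[/andP[_ jn] _]; rewrite mulr_ge0_le0 ?ballot_ge0//.
by rewrite subr_le0 two_step_le//; lia.
Qed.

Lemma treesum_eq_continuation n u b : (0 < b)%N -> (0 < n)%N ->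
  u / b%:R < value u b -> treesum n u b = continuation u b.
Proof.
case: n => // n b0 _ ub; rewrite -treesum1; elim: n => [//|n <-].
apply/eqP; rewrite -subr_eq0 treesumS_eq big_nat_cond big1 ?mulr0// => j.
move=> /andP[/andP[j1 jn] _]; apply/eqP; rewrite mulf_eq0.
apply/orP; right; rewrite subr_eq0.
(* As [j >= 1], the position [v] below and its two successors are at most [u], so continuing is
   optimal at all three. *)
have j2 : 2 <= (2 * j)%:R :> R by rewrite ler_nat; lia.
have Wc u' b' : (b <= b')%N -> u' <= u -> value u' b' = continuation u' b'.
  by move=> bb' u'u; exact: value_continue ub.
set v := u - _ + 1; set c := (b + _ + 1)%N.
have vu : v + 1 <= u by rewrite /v; lra.
have bc : (b <= c)%N by rewrite /c; lia.
rewrite two_stepE (Wc v c)//; last by lra.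
by rewrite [eqbRHS]/continuation !Wc ?(leqW bc)//; lra.
Qed.

End tree.

(** * Stopping times of the walk *)

Lemma measurable_Vfin (R : realType) N (u : R) b :
  measurable_fun setT (fun s : R => Vfin N (u + s) b).
Proof.
have shift (v : R) : measurable_fun setT (fun s : R => v + s).
  by apply: measurable_funD.
suff H : measurable_fun setT (fun s : R => Vfin N s b).
  exact: (measurableT_comp H (shift u)).
elim: N b => [|N IHN] b /=; first by apply: measurable_funM.
apply: measurable_maxr; apply: measurable_funM => //.
apply: measurable_funD.
- exact: (measurableT_comp (IHN b.+1)
    (measurable_funD (@measurable_id _ _ _) (measurable_cst _))).
- exact: (measurableT_comp (IHN b.+1)
    (measurable_funD (@measurable_id _ _ _) (measurable_cst _))).
Qed.

Section walk_value.
Context {d : measure_display} {Omega : measurableType d} {R : realType}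
        {P : probability Omega R} {X : nat -> {RV P >-> R}}.
Hypotheses (hindep : mutually_independent X) (hsigns : fair_signs X).

(** * Cylinders of the walk *)

Definition step (c : bool) : R := if c then 1 else -1.

(** Cylinders of a given length cover [Omega] only almost surely, since [X i] may differ from 1 and
    -1 on a null set. *)
Definition cyl (h : seq bool) : set Omega :=
  [set w | forall i, (i < size h)%N -> X i w = step (nth true h i)].

Definition endpoint (h : seq bool) : R := \sum_(c <- h) step c.

Lemma measurable_step i c : measurable (X i @^-1` [set step c]).
Proof. exact: measurable_funPTI. Qed.

Lemma cylE h : cyl h = \bigcap_(i in [set` [fset i in iota 0 (size h)]%fset])
  (X i @^-1` [set step (nth true h i)]).
Proof.
apply/seteqP; split => w /= hw i.
  by rewrite /= inE /= mem_iota add0n => /hw.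
by move=> ih; apply: hw; rewrite /= inE /= mem_iota add0n.
Qed.

Lemma measurable_cyl h : measurable (cyl h).
Proof.
rewrite cylE; apply: bigcap_measurableType => i _; exact: measurable_step.
Qed.

Lemma prob_cyl h : P (cyl h) = (2 ^- size h)%:E.
Proof.
rewrite cylE hindep => [|i]; last exact: measurable_set1.
rewrite (eq_bigr (fun=> (2^-1)%:E)); last first.
  by move=> i _; rewrite /step; have [? ?] := hsigns i; case: nth.
rewrite big_const_seq count_predT.
have -> : size [fset i in iota 0 (size h)]%fset = size h.
  by rewrite card_fseq undup_id ?iota_uniq// size_iota.
elim: (size h) => [|n IHn]; first by rewrite expr0 invr1.
by rewrite iterS IHn -EFinM exprS invfM.
Qed.

Lemma cyl_nonempty h : exists w, cyl h w.
Proof.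
apply: contrapT => /forallNP H; have := prob_cyl h.
rewrite (_ : cyl h = set0) ?measure0; last by apply/seteqP; split => w // /H.
by move=> [] /eqP; rewrite eq_sym invr_eq0 expf_eq0 pnatr_eq0 andbF.
Qed.

Lemma cyl_rcons h c w :
  cyl (rcons h c) w <-> cyl h w /\ X (size h) w = step c.
Proof.
split => [H|[H1 H2] i].
  split=> [i ih|].
    by rewrite H ?size_rcons ?ltnS ?(ltnW ih)// nth_rcons ih.
  by rewrite H ?size_rcons// nth_rcons ltnn eqxx.
rewrite size_rcons ltnS leq_eqVlt nth_rcons => /predU1P[->|ih].
  by rewrite ltnn eqxx.
by rewrite ih H1.
Qed.

Lemma walk_cyl h k w : cyl h w -> (k <= size h)%N ->
  walk X k w = endpoint (take k h).
Proof.
move=> hw kh.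
rewrite /walk /endpoint (big_nth true) size_take_min (minn_idPl kh).
rewrite big_mkord; apply: eq_bigr => i _.
by rewrite nth_take// hw// (leq_trans _ kh).
Qed.

Lemma walk_cyl_size h w : cyl h w -> walk X (size h) w = endpoint h.
Proof. by move=> /walk_cyl ->//; rewrite take_size. Qed.

Lemma endpoint_rcons h c : endpoint (rcons h c) = endpoint h + step c.
Proof. by rewrite /endpoint big_rcons/=. Qed.

Lemma ae_step : {ae P, forall w i, X i w = 1 \/ X i w = -1}.
Proof.
apply: ae_foralln => i.
have m1 := measurable_step i true; have m2 := measurable_step i false.
exists (~` (X i @^-1` [set 1] `|` X i @^-1` [set -1])); split => //.
- by apply: measurableC; apply: measurableU.
- rewrite [LHS](probability_setC P (measurableU _ _ m1 m2)).
  rewrite measureU//; last first.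
    apply/seteqP; split => w //= [-> /eqP].
    by rewrite -subr_eq0 opprK -(natrD _ 1 1) pnatr_eq0.
  have [h1 h2] := hsigns i.
  rewrite [X in (1 - (X + _))%E]h1 [X in (1 - (_ + X))%E]h2 -EFinD.
  by apply/eqP; rewrite /= eqe; apply/eqP; lra.
Qed.

(** * Events of the natural filtration *)

Lemma measurable_walk k : measurable_fun setT (walk X k).
Proof. by apply: measurable_sum => i; exact: measurable_funPT. Qed.

Lemma natural_filtration_measurable n A :
  natural_filtration X n A -> measurable A.
Proof.
apply: smallest_sub; first exact: sigma_algebra_measurable.
move=> _ [k _ [B mB <-]]; exact: measurable_walk.
Qed.

Lemma natural_filtration_walk n k B : (k <= n)%N -> measurable B ->
  natural_filtration X n (walk X k @^-1` B).
Proof.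
move=> kn mB; apply: sub_sigma_algebra; exists k => //.
by exists B => //; rewrite setTI.
Qed.

Lemma natural_filtration_homo m n : (m <= n)%N ->
  natural_filtration X m `<=` natural_filtration X n.
Proof.
move=> mn; apply: smallest_sub; first exact: smallest_sigma_algebra.
by move=> _ [k /= km [B mB <-]]; rewrite setTI;
  apply: natural_filtration_walk => //; lia.
Qed.

Lemma sigma_algebra_natural_filtration n :
  sigma_algebra setT (natural_filtration X n).
Proof. exact: smallest_sigma_algebra. Qed.

Lemma natural_filtrationC n A :
  natural_filtration X n A -> natural_filtration X n (~` A).
Proof.
by rewrite -setTD; case: (sigma_algebra_natural_filtration n) => _ + _; apply.
Qed.

Lemma natural_filtration_bigcup n (A : (set Omega)^nat) :
  (forall i, natural_filtration X n (A i)) ->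
  natural_filtration X n (\bigcup_i A i).
Proof. by case: (sigma_algebra_natural_filtration n) => _ _; apply. Qed.

Lemma natural_filtration0 n : natural_filtration X n set0.
Proof. by case: (sigma_algebra_natural_filtration n). Qed.

(** The sets that contain or miss [cyl h] form a sigma-algebra. It contains the generators because
    the walk at each time up to [size h] is constant on [cyl h]. *)
Lemma natural_filtration_cyl h A : natural_filtration X (size h) A ->
  cyl h `<=` A \/ cyl h `<=` ~` A.
Proof.
move: A; apply: smallest_sub; last first.
  move=> _ [k /= kh [B mB <-]]; rewrite setTI.
  have [Bh|Bh] := pselect (B (endpoint (take k h))); [left|right] => w hw /=;
    by rewrite (walk_cyl hw).
split=> [|A [hA|hA]|A hA].
- by right => w _.
- by right => w /hA Aw [].
- by left => w /hA Aw; split.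
- have [[i hi]|/forallNP hN] := pselect (exists i, cyl h `<=` A i).
    by left => w /hi; exists i.
  by right => w hw [i _ Aw]; have [/hN|/(_ w hw)] := hA i.
Qed.


(** * Payoffs integrated over cylinders *)

Lemma measurable_payoff tau u b : stopping_time X tau ->
  measurable_fun setT (payoff X u b tau).
Proof.
move=> st _ B mB; rewrite setTI.
have mtau k : measurable [set w | tau w = Some k].
  exact: natural_filtration_measurable (st k).
pose f k w := (u + walk X k w) / (b + k)%:R.
have mf k : measurable (f k @^-1` B).
  rewrite -[_ @^-1` _]setTI; apply: (_ : measurable_fun setT (f k)) => //.
  apply: measurable_funM => //; apply: measurable_funD => //.
  exact: measurable_walk.
rewrite (_ : _ @^-1` B =
    \bigcup_k ([set w | tau w = Some k] `&` f k @^-1` B) `|`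
    ((~` \bigcup_k [set w | tau w = Some k]) `&` (cst 0 @^-1` B))).
  apply: measurableU.
    by apply: bigcupT_measurable => k; exact: measurableI.
  apply: measurableI.
    by apply: measurableC; exact: bigcupT_measurable.
  by rewrite -[_ @^-1` _]setTI; exact: measurable_cst.
apply/seteqP; split => w /=; rewrite /payoff.
  case E: (tau w) => [k|] Bw; first by left; exists k.
  by right; split => //= -[k _ /=]; rewrite E.
move=> [[k _ [/= -> fB]]|[tN B0]]; first exact: fB.
by case E: (tau w) => [k|//]; case: tN; exists k.
Qed.

(** The outcomes of [cyl h] outside both subcylinders have a step other than 1 and -1 at index
    [size h], hence form a null set. *)
Lemma integral_cyl_split h (f : Omega -> \bar R) : measurable_fun setT f ->
  (\int[P]_(w in cyl h) f w = \int[P]_(w in cyl (rcons h true)) f w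
     + \int[P]_(w in cyl (rcons h false)) f w)%E.
Proof.
move=> mf; set C1 := cyl (rcons h true); set C0 := cyl (rcons h false).
have m1 : measurable C1 by exact: measurable_cyl.
have m0 : measurable C0 by exact: measurable_cyl.
have mh := measurable_cyl h.
have m10 : measurable (C1 `|` C0) by exact: measurableU.
pose N := cyl h `\` (C1 `|` C0).
have mN : measurable N by exact: measurableD.
have PN : P N = 0.
  apply: measure_negligible => //.
  apply: negligibleS ae_step => w [hw NC] /= /(_ (size h)) Xw.
  by apply: NC; case: Xw => Xw; [left|right]; apply/cyl_rcons.
have -> : cyl h = (C1 `|` C0) `|` N.
  apply/seteqP; split => w.
    by move=> hw; have [?|?] := pselect ((C1 `|` C0) w); [left|right].
  by move=> [[/cyl_rcons[]|/cyl_rcons[]]|[]].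
have mfS A : measurable_fun A f by exact: measurable_funTS.
rewrite integral_setU//; last by apply/disj_setPS => w [? []].
rewrite (null_set_integral mN)// adde0 integral_setU//.
apply/disj_setPS => w [/cyl_rcons[_ X1] /cyl_rcons[_]]; rewrite X1 => /eqP.
by rewrite /step -subr_eq0 opprK -(natrD _ 1 1) pnatr_eq0.
Qed.

Lemma integral_cyl_stop h tau u b :
  cyl h `<=` [set w | tau w = Some (size h)] ->
  (\int[P]_(w in cyl h) (payoff X u b tau w)%:E =
   (2 ^- size h * ((u + endpoint h) / (b + size h)%:R))%:E)%E.
Proof.
move=> hA; rewrite EFinM -prob_cyl muleC -integral_cst;
  last exact: measurable_cyl.
apply: eq_integral => w; rewrite inE => hw.
by rewrite /payoff (hA _ hw) walk_cyl_size.
Qed.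

Lemma pow2V_rcons (h : seq bool) c :
  2 ^- size (rcons h c) = 2 ^- size h / 2 :> R.
Proof. by rewrite size_rcons exprS invfM mulrC. Qed.

(** Backward induction, with [m] steps left. On [cyl h], [tau] equals [size h] everywhere or
    nowhere; in the latter case the lower bound on [tau] passes to both subcylinders, increased by
    one. *)
Lemma integral_cyl_le N tau u b : stopping_time X tau ->
    (forall w, exists2 k, (k <= N)%N & tau w = Some k) ->
  forall m h, (size h + m)%N = N ->
    (forall w k, cyl h w -> tau w = Some k -> (size h <= k)%N) ->
  (\int[P]_(w in cyl h) (payoff X u b tau w)%:E <=
   (2 ^- size h * Vfin m (u + endpoint h) (b + size h))%:E)%E.
Proof.
move=> st tauN; elim=> [|m IHm] h hN hle.
  rewrite integral_cyl_stop// => w hw /=.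
  have [k kN tk] := tauN w; have := hle _ _ hw tk.
  by rewrite tk => ?; congr Some; lia.
have [hA|hA] := natural_filtration_cyl (st (size h)).
  rewrite integral_cyl_stop// lee_fin ler_pM2l ?invr_gt0 ?exprn_gt0//.
  exact: le_Vfin_stop.
rewrite integral_cyl_split; last first.
  exact/measurable_EFinP/measurable_payoff.
have IH c : (\int[P]_(w in cyl (rcons h c)) (payoff X u b tau w)%:E <=
   (2 ^- size (rcons h c) *
    Vfin m (u + endpoint (rcons h c)) (b + size (rcons h c)))%:E)%E.
  apply: IHm; first by rewrite size_rcons; lia.
  move=> w k /cyl_rcons[hw _] tk; rewrite size_rcons ltn_neqAle (hle w)// andbT.
  by apply/eqP => hk; apply: (hA w hw); rewrite /= hk.
apply: (le_trans (leeD (IH true) (IH false))).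
rewrite -EFinD lee_fin !pow2V_rcons !endpoint_rcons !size_rcons !addnS.
rewrite !addrA -mulrDr -mulrA.
rewrite ler_pM2l ?invr_gt0 ?exprn_gt0// mulrC /= le_max; apply/orP; right.
by rewrite /step.
Qed.

(** The two optimality hypotheses make the inequalities of [integral_cyl_le] sharp: [tau] stops only
    where the payoff attains [Vfin], and goes on only where it falls short of it. *)
Lemma integral_cyl_ge N tau u b : stopping_time X tau ->
    (forall w, exists2 k, (k <= N)%N & tau w = Some k) ->
    (forall w k, tau w = Some k ->
      Vfin (N - k) (u + walk X k w) (b + k) <=
      (u + walk X k w) / (b + k)%:R) ->
    (forall w k j, tau w = Some k -> (j < k)%N ->
      (u + walk X j w) / (b + j)%:R <
      Vfin (N - j) (u + walk X j w) (b + j)) ->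
  forall m h, (size h + m)%N = N ->
    (forall w k, cyl h w -> tau w = Some k -> (size h <= k)%N) ->
  ((2 ^- size h * Vfin m (u + endpoint h) (b + size h))%:E <=
   \int[P]_(w in cyl h) (payoff X u b tau w)%:E)%E.
Proof.
move=> st tauN opt_stop opt_cont; elim=> [|m IHm] h hN hle.
  rewrite integral_cyl_stop// => w hw /=.
  have [k kN tk] := tauN w; have := hle _ _ hw tk.
  by rewrite tk => ?; congr Some; lia.
have [hA|hA] := natural_filtration_cyl (st (size h)).
  rewrite integral_cyl_stop// lee_fin ler_pM2l ?invr_gt0 ?exprn_gt0//.
  have [w hw] := cyl_nonempty h; have := opt_stop w (size h) (hA w hw).
  by rewrite walk_cyl_size// -hN addKn.
have hlt w k : cyl h w -> tau w = Some k -> (size h < k)%N.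
  move=> hw tk; rewrite ltn_neqAle (hle w)// andbT.
  by apply/eqP => hk; apply: (hA w hw); rewrite /= hk.
rewrite integral_cyl_split; last first.
  exact/measurable_EFinP/measurable_payoff.
have IH c : ((2 ^- size (rcons h c) *
     Vfin m (u + endpoint (rcons h c)) (b + size (rcons h c)))%:E <=
   \int[P]_(w in cyl (rcons h c)) (payoff X u b tau w)%:E)%E.
  apply: IHm; first by rewrite size_rcons; lia.
  by move=> w k /cyl_rcons[hw _] tk; rewrite size_rcons (hlt w).
apply: (le_trans _ (leeD (IH true) (IH false))).
rewrite -EFinD lee_fin !pow2V_rcons !endpoint_rcons !size_rcons !addnS.
rewrite !addrA -mulrDr -mulrA.
rewrite ler_pM2l ?invr_gt0 ?exprn_gt0// mulrC /=.
(* The outcomes of the cylinder share their position at time [size h], so one of them shows that the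
   maximum is the continuation branch. *)
have [w hw] := cyl_nonempty h; have [k kN tk] := tauN w.
have := opt_cont _ _ _ tk (hlt _ _ hw tk).
rewrite walk_cyl_size// -hN addKn /= lt_max ltxx/= => /ltW/max_idPr ->.
by rewrite /step.
Qed.


Lemma cyl_nil : cyl [::] = setT.
Proof. by apply/seteqP; split. Qed.

Lemma endpoint_nil : endpoint [::] = 0.
Proof. by rewrite /endpoint big_nil. Qed.

Lemma expectation_le_Vfin N tau u b : stopping_time X tau ->
    (forall w, exists2 k, (k <= N)%N & tau w = Some k) ->
  ('E_P[payoff X u b tau] <= (Vfin N u b)%:E)%E.
Proof.
move=> st tauN.
have := @integral_cyl_le N tau u b st tauN N [::] (add0n _)
  (fun _ _ _ _ => leq0n _).
by rewrite unlock cyl_nil endpoint_nil expr0 invr1 mul1r addr0 addn0.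
Qed.

(** * An optimal time for a finite horizon *)

Definition stop_rule N u b k : set R :=
  [set s | Vfin (N - k) (u + s) (b + k) <= (u + s) / (b + k)%:R].

Lemma measurable_stop_rule N u b k : measurable (stop_rule N u b k).
Proof.
rewrite -[stop_rule _ _ _ _]setTI; apply: measurable_fun_le => //.
  exact: measurable_Vfin.
by apply: measurable_funM => //; exact: measurable_funD.
Qed.

(** The search succeeds by time [N], where the rule always holds since [Vfin 0] is the stopping
    payoff. *)
Definition opt_time N u b (w : Omega) : option nat :=
  Some (find (fun k => `[< stop_rule N u b k (walk X k w) >]) (iota 0 N.+1)).

Lemma opt_timeP N u b w k : opt_time N u b w = Some k <->
  [/\ (k <= N)%N, stop_rule N u b k (walk X k w) &
      forall j, (j < k)%N -> ~ stop_rule N u b j (walk X j w)].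
Proof.
rewrite /opt_time; set p := fun k => _.
have hasp : has p (iota 0 N.+1).
  apply/hasP; exists N; first by rewrite mem_iota add0n leq0n ltnS leqnn.
  by apply/asboolP; rewrite /stop_rule/= subnn/= lexx.
have fN : (find p (iota 0 N.+1) <= N)%N.
  by move: (hasp); rewrite has_find size_iota.
have rf : stop_rule N u b (find p (iota 0 N.+1))
                          (walk X (find p (iota 0 N.+1)) w).
  by have := nth_find 0 hasp; rewrite nth_iota ?ltnS// add0n => /asboolP.
have rb j : (j < find p (iota 0 N.+1))%N -> ~ stop_rule N u b j (walk X j w).
  move=> jf; have := before_find 0 jf; rewrite nth_iota ?add0n; last first.
    by rewrite ltnS (leq_trans (ltnW jf)).
  by move=> /asboolP.
move: (find _ _) fN rf rb => f fN rf rb.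
split=> [[<-]//|[kN rk rj]]; congr Some.
by have [/rj|/rb|//] := ltngtP f k.
Qed.

Lemma stopping_time_opt_time N u b : stopping_time X (opt_time N u b).
Proof.
move=> k; have [kN|Nk] := leqP k N; last first.
  rewrite (_ : [set _ | _] = set0); first exact: natural_filtration0.
  by apply/seteqP; split => w //= /opt_timeP[]; rewrite leqNgt Nk.
(* The complement is a countable union: the rule holds at some [i < k], or it fails at [k], an event
   repeated for all [i >= k]. *)
pose A i : set Omega := if (i < k)%N then walk X i @^-1` stop_rule N u b i
  else ~` (walk X k @^-1` stop_rule N u b k).
rewrite (_ : [set _ | _] = ~` \bigcup_i A i).
  apply: natural_filtrationC; apply: natural_filtration_bigcup => i.
  rewrite /A; case: ifPn => ik; last apply: natural_filtrationC.
    exact: natural_filtration_walk (ltnW ik) (measurable_stop_rule _ _ _ _).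
  exact: natural_filtration_walk (leqnn _) (measurable_stop_rule _ _ _ _).
apply/seteqP; split => w /=.
  move=> /opt_timeP[_ rk rj] [i _]; rewrite /A.
  case: ifPn => ik; last by move=> /(_ rk).
  exact: rj.
move=> NA; apply/opt_timeP; split => //.
  by apply: contrapT => Nr; apply: NA; exists k; rewrite // /A ltnn.
by move=> j jk rj; apply: NA; exists j; rewrite // /A jk.
Qed.

Lemma opt_time_bounded N u b w :
  exists2 k, (k <= N)%N & opt_time N u b w = Some k.
Proof.
case E: (opt_time N u b w) => [k|//]; exists k => //.
by have /opt_timeP[] := E.
Qed.

Lemma Vfin_le_expectation N u b :
  ((Vfin N u b)%:E <= 'E_P[payoff X u b (opt_time N u b)])%E.
Proof.
have := @integral_cyl_ge N _ u b (stopping_time_opt_time N u b)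
  (@opt_time_bounded N u b) _ _ N [::] (add0n _) (fun _ _ _ _ => leq0n _).
rewrite unlock cyl_nil endpoint_nil expr0 invr1 mul1r addr0 addn0; apply.
  by move=> w k /opt_timeP[].
by move=> w k j /opt_timeP[_ _ /[apply]] /negP; rewrite -ltNge.
Qed.

(** * Truncation and passage to the unbounded problem *)

Definition truncated_time (tau : Omega -> option nat) N w : option nat :=
  Some (if tau w is Some k then minn k N else N).

Lemma stopping_time_truncated tau N :
  stopping_time X tau -> stopping_time X (truncated_time tau N).
Proof.
move=> st k; have [kN|Nk|->] := ltngtP k N.
- rewrite (_ : [set _ | _] = [set w | tau w = Some k]); first exact: st.
  apply/seteqP; split => w /=; rewrite /truncated_time; last first.
    by move=> ->; rewrite (minn_idPl (ltnW kN)).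
  case: (tau w) => [j|] [] jk; last by move: kN; rewrite jk ltnn.
  by congr Some; lia.
- rewrite (_ : [set _ | _] = set0); first exact: natural_filtration0.
  apply/seteqP; split => w //=; rewrite /truncated_time.
  by case: (tau w) => [j|] []; lia.
(* The truncated time is [N] exactly when [tau] is not below [N], which includes [tau = None]. *)
- rewrite (_ : [set _ | _] =
      ~` \bigcup_i (if (i < N)%N then [set w | tau w = Some i] else set0)).
    apply: natural_filtrationC; apply: natural_filtration_bigcup => i.
    case: ifPn => iN; last exact: natural_filtration0.
    by apply: natural_filtration_homo (st i); exact: ltnW.
  apply/seteqP; split => w /=; rewrite /truncated_time.
    move=> tN [i _]; case: ifPn => // iN /= ti; move: tN; rewrite ti => -[].
    by lia.
  move=> NA; case E: (tau w) => [j|//]; congr Some.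
  apply/minn_idPr; rewrite leqNgt; apply/negP => jN.
  by apply: NA; exists j => //; rewrite jN.
Qed.

(** After [k] unit steps the walk is at most [k <= b + k] in absolute value. The bound, free of
    [tau], dominates all truncated payoffs at once. *)
Lemma payoff_bound tau u b w : (0 < b)%N ->
  (forall i, X i w = 1 \/ X i w = -1) -> `|payoff X u b tau w| <= `|u| + 1.
Proof.
move=> b0 Xw; rewrite /payoff; case: (tau w) => [k|]; last first.
  by rewrite normr0 addr_ge0.
have bk : 0 < (b + k)%:R :> R by rewrite ltr0n addn_gt0 b0.
rewrite normrM normfV (gtr0_norm bk) ler_pdivrMr//.
have wk : `|walk X k w| <= k%:R.
  rewrite /walk (le_trans (ler_norm_sum _ _ _))//.
  rewrite -[leRHS]mulr1 -[k in leRHS]card_ord mulr_natl -sumr_const.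
  by apply: ler_sum => i _; case: (Xw i) => ->; rewrite ?normrN normr1.
rewrite (le_trans (ler_normD _ _))// mulrDl mul1r lerD//.
  by rewrite ler_peMr// ler1n addn_gt0 b0.
by rewrite (le_trans wk)// ler_nat leq_addl.
Qed.

Lemma expectation_le_value tau u b : (0 < b)%N ->
  ae_finite_stopping_time X tau ->
  ('E_P[payoff X u b tau] <= (value u b)%:E)%E.
Proof.
move=> b0 [st fin]; rewrite unlock.
have mpay sigma : stopping_time X sigma ->
    measurable_fun setT (EFin \o payoff X u b sigma).
  by move=> ?; exact/measurable_EFinP/measurable_payoff.
(* Where [tau] is finite, the truncated payoffs eventually equal that of [tau]. *)
have cvg_trunc : {ae P, forall w, setT w ->
    (EFin \o payoff X u b (truncated_time tau N)) w @[N --> \oo] -->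
    (EFin \o payoff X u b tau) w}.
  apply: filterS fin => w; case E: (tau w) => [k|//] _ _.
  apply: cvg_near_cst; exists k => // N /= kN.
  by rewrite /payoff /truncated_time E (minn_idPl kN).
have bound_trunc : {ae P, forall w N, setT w ->
    (`|(EFin \o payoff X u b (truncated_time tau N)) w| <=
     (EFin \o cst (`|u| + 1)%R) w)%E}.
  apply: filterS ae_step => w Xw N _.
  by rewrite /= lee_fin payoff_bound.
have [_ _ lim_trunc] := @dominated_convergence _ _ _ P setT measurableT
  (fun N => EFin \o payoff X u b (truncated_time tau N))
  (EFin \o payoff X u b tau) (EFin \o cst (`|u| + 1))
  (fun N => mpay _ (stopping_time_truncated N st)) (mpay _ st)
  cvg_trunc (finite_measure_integrable_cst P _ measurableT) bound_trunc.
apply: cvge_le lim_trunc; apply: nearW => N.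
have := @expectation_le_Vfin N _ u b (stopping_time_truncated N st).
rewrite unlock => /(_ _)/le_trans; apply.
  move=> w; rewrite /truncated_time; case: (tau w) => [k|]; last by exists N.
  by exists (minn k N) => //; exact: geq_minr.
by rewrite lee_fin Vfin_le_value.
Qed.

Lemma V_value u b : (0 < b)%N -> V X u b = (value u b)%:E.
Proof.
move=> b0; have Vle : (V X u b <= (value u b)%:E)%E.
  by apply: ge_ereal_sup => _ [tau fin <-]; exact: expectation_le_value.
apply/eqP; rewrite eq_le Vle/=.
have VN N : ((Vfin N u b)%:E <= V X u b)%E.
  apply: le_trans (Vfin_le_expectation N u b) _.
  apply: ereal_sup_ubound; exists (opt_time N u b) => //.
  by split; [exact: stopping_time_opt_time|exact: aeW].
(* The upper bound excludes +oo, and horizon 0 excludes -oo. *)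
case: (V X u b) Vle VN => [r||] //= _ VN.
  by rewrite lee_fin; apply: value_le => N; rewrite -lee_fin.
by have := VN 0%N.
Qed.

Lemma TreeSumE n u b : (0 < b)%N -> (0 < n)%N ->
  TreeSum X n u b = (treesum n u b)%:E.
Proof.
move=> b0 n0; rewrite /TreeSum /treesum EFinD EFinM -!sumEFin.
congr (_ + _ * _)%E; apply: eq_big_nat => i _; rewrite V_value ?EFinM//; lia.
Qed.

End walk_value.

Theorem lemma2p2 (d : measure_display) (Omega : measurableType d)
    (R : realType) (P : probability Omega R) (X : nat -> {RV P >-> R})
    (hindep : mutually_independent X) (hsigns : fair_signs X)
    (u : R) (b n : nat) (hb : (0 < b)%N) (hn : (1 <= n)%N) :
  [/\ V X u b = maxe (u / b%:R)%:E (TreeSum X n u b),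
      ((TreeSum X n u b <= (u / b%:R)%:E)%E -> V X u b = (u / b%:R)%:E),
      (~ (TreeSum X n u b <= (u / b%:R)%:E)%E -> ((u / b%:R)%:E < V X u b)%E) &
      (((u / b%:R)%:E < TreeSum X 1 u b)%E ->
        TreeSum X 1 u b = TreeSum X n u b)].
Proof.
rewrite !TreeSumE// V_value// treesum1 !lee_fin !lte_fin.
have bellman := value_bellman u hb.
have value_tree : value u b = Num.max (u / b%:R) (treesum n u b).
  (* If stopping is optimal, the tree sum is at most the continuation value, so both maxima are
     [u / b]; otherwise the two are equal. *)
  have [stop|cont] := leP (continuation u b) (u / b%:R).
    rewrite bellman (max_idPl stop).
    by rewrite (max_idPl (le_trans (treesum_le_continuation _ _ _) stop)).
  by rewrite (@treesum_eq_continuation _ n)// bellman lt_max cont orbT.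
split.
- by rewrite value_tree EFin_max.
- by move=> /max_idPl stop; rewrite value_tree stop.
- by move=> /negP; rewrite -ltNge value_tree lt_max => ->; rewrite orbT.
- by move=> cont; rewrite treesum_eq_continuation// bellman lt_max cont orbT.
Qed.
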